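(* Every member of $\mathcal{B}$ is isomorphic to some restriction of $I_{wf}$; that is, for every $I\in\mathcal{B}$ there is $A\subseteq\mathbb{N}^{<\omega}$ such that $I$ is isomorphic to $I_{wf}\upharpoonright A$.
   Context: An ideal over a countable set $X$ is a family of subsets of $X$ that contains every finite subset of $X$ and is closed under taking subsets and finite unions ($\mathcal{P}(X)$ is allowed). Two ideals $I$ on $X$ and $J$ on $Y$ are isomorphic if there is a bijection $f:X\to Y$ such that $A\in I$ iff $f[A]\in J$. For $K\subseteq X$, $I\upharpoonright K$ is the ideal on $K$ consisting of all subsets of $K$ belonging to $I$. The orthogonal of $I$ is $I^\perp=\{B\subseteq X: A\cap B\text{ is finite for all }A\in I\}$. Direct sum: given finitely or countably many ideals $I_n$ on countably infinite sets $X_n$, take a partition $\{K_n\}$ of $\mathbb{N}$ and an isomorphic copy $I_n'$ of $I_n$ on $K_n$; then $A\in\bigoplus_n I_n$ iff $A\cap K_n\in I_n'$ for all $n$ (well defined up to isomorphism). $\mathcal{B}$ is the smallest collection of ideals on $\mathbb{N}$ (regarded as closed under isomorphism) containing the ideal of finite sets and closed under countable (including finite) direct sums and orthogonal. $\mathbb{N}^{<\omega}$ is the set of finite sequences of natural numbers, ordered by extension $\preceq$; a tree is a $\preceq$-downward closed subset; a tree is well founded if it has no infinite branch. $I_{wf}$ is the ideal on $\mathbb{N}^{<\omega}$ generated by the well founded trees: $A\in I_{wf}$ iff $A$ is contained in a well founded tree. *)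

(* Defs.v *)
From mathcomp Require Import all_boot.
From mathcomp Require Import boolp classical_sets functions cardinality.

Set Implicit Arguments.
Unset Strict Implicit.
Unset Printing Implicit Defensive.

Local Open Scope classical_set_scope.

(* An ideal over a carrier X, itself a subset of an ambient type, is a family
   of subsets of X; it need not be proper. *)
Record is_ideal (T : Type) (X : set T) (I : set (set T)) : Prop := IsIdeal {
  ideal_countable : countable X;
  ideal_carrier : forall A, I A -> A `<=` X;
  ideal_finite : forall A, A `<=` X -> finite_set A -> I A;
  ideal_sub : forall A B, A `<=` B -> I B -> I A;
  ideal_setU : forall A B, I A -> I B -> I (A `|` B) }.

Definition ideal_iso (S T : Type) (X : set S) (I : set (set S))
    (Y : set T) (J : set (set T)) : Prop :=
  exists2 f : S -> T, set_bij X Y f &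
    forall A, A `<=` X -> (I A <-> J (f @` A)).

Definition restriction (T : Type) (I : set (set T)) (K : set T) : set (set T) :=
  [set A | A `<=` K /\ I A].

Definition orthogonal (T : Type) (X : set T) (I : set (set T)) : set (set T) :=
  [set B | B `<=` X /\ forall A, I A -> finite_set (A `&` B)].

(* J is a direct sum, realized on nat, of the ideals I n on X n, where n ranges
   over an index set D of naturals, finite or infinite: K n are the pieces of
   the partition and I' n is the isomorphic copy of I n on K n.  As the K n
   cover nat, D is nonempty. *)
Definition is_direct_sum (T : Type) (D : set nat) (X : nat -> set T)
    (I : nat -> set (set T)) (J : set (set nat)) : Prop :=
  exists (K : nat -> set nat) (I' : nat -> set (set nat)),
  [/\ partition D K [set: nat],
      forall n, D n -> is_ideal (K n) (I' n) /\
                       ideal_iso (X n) (I n) (K n) (I' n)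
    & J = [set A | forall n, D n -> I' n (A `&` K n)]].

Inductive BB : set (set nat) -> Prop :=
| BB_fin : BB [set A | finite_set A]
| BB_iso I J : BB I -> is_ideal [set: nat] J ->
    ideal_iso [set: nat] I [set: nat] J -> BB J
| BB_orthogonal I : BB I -> BB (orthogonal [set: nat] I)
| BB_direct_sum (D : set nat) (I : nat -> set (set nat)) J :
    (forall n, D n -> BB (I n)) ->
    is_direct_sum D (fun=> [set: nat]) I J -> BB J.

Definition tree (T : set (seq nat)) : Prop :=
  forall s t, prefix s t -> T t -> T s.

(* mkseq x n is the initial segment of length n of the infinite sequence x. *)
Definition infinite_branch (T : set (seq nat)) (x : nat -> nat) : Prop :=
  forall n, T (mkseq x n).

Definition well_founded_tree (T : set (seq nat)) : Prop :=
  tree T /\ ~ exists x, infinite_branch T x.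

Definition Iwf : set (set (seq nat)) :=
  [set A | exists2 T, well_founded_tree T & A `<=` T].

Lemma restriction_ideal (T : Type) (X : set T) I K :
  K `<=` X -> is_ideal X I -> is_ideal K (restriction I K).
Proof.
move=> KX [cX sX fX dX uX]; split.
- exact: sub_countable (subset_card_le KX) cX.
- by move=> A [].
- by move=> A AK fA; split=> //; apply: fX => // x /AK /KX.
- by move=> A B AB [BK IB]; split; [exact: subset_trans AB BK|exact: dX AB IB].
- by move=> A B [AK IA] [BK IB]; split; [rewrite subUset|exact: uX].
Qed.

Lemma orthogonal_ideal (T : Type) (X : set T) I :
  countable X -> is_ideal X (orthogonal X I).
Proof.
move=> cX; split=> //.
- by move=> A [].
- by move=> A AX fA; split=> // B _; exact: finite_setIr.
- move=> A B AB [BX h]; split; first exact: subset_trans AB BX.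
  by move=> C /h; apply: sub_finite_set => x [Cx /AB].
- move=> A B [AX hA] [BX hB]; split; first by rewrite subUset.
  by move=> C IC; rewrite setIUr finite_setU; split; [exact: hA|exact: hB].
Qed.

Lemma direct_sum_ideal (T : Type) D (X : nat -> set T) I J :
  is_direct_sum D X I J -> is_ideal [set: nat] J.
Proof.
move=> [K [I' [_ h ->]]]; split=> //.
- by move=> A _ fA n /h[[_ _ fK _ _] _]; apply: fK; [move=> x []|exact: finite_setIl].
- move=> A B AB JB n Dn; have [[_ _ _ dK _] _] := h _ Dn.
  by apply: dK (JB _ Dn) => x [/AB].
- move=> A B JA JB n Dn; have [[_ _ _ _ uK] _] := h _ Dn.
  by rewrite setIUl; apply: uK; [exact: JA|exact: JB].
Qed.

Lemma BB_ideal I : BB I -> is_ideal [set: nat] I.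
Proof.
case=> {I} [|//|I _|D I J _ /direct_sum_ideal//]; last exact: orthogonal_ideal.
split=> //; first by move=> A B AB; exact: sub_finite_set AB.
by move=> A B fA fB; rewrite /= finite_setU.
Qed.

Lemma well_founded_treeU S T : well_founded_tree S -> well_founded_tree T ->
  well_founded_tree (S `|` T).
Proof.
move=> [tS nS] [tT nT]; split.
  by move=> s t st [/(tS _ _ st)|/(tT _ _ st)]; [left|right].
have pre (x : nat -> nat) m n : m <= n -> prefix (mkseq x m) (mkseq x n).
  by move=> mn; rewrite /mkseq -(subnKC mn) iotaD map_cat prefix_prefix.
move=> [x xST]; apply: nS; exists x => m; apply: contrapT => nSm.
apply: nT; exists x => n.
have [|] := xST (maxn m n).
  by move=> /(tS _ _ (pre x _ _ (leq_maxl m n))).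
exact: tT (pre x _ _ (leq_maxr m n)).
Qed.

Lemma Iwf_ideal : is_ideal [set: seq nat] Iwf.
Proof.
split=> //.
- move=> A _ /finite_seqP[s ->]; exists [set t | exists2 u, u \in s & prefix t u].
    split; first by move=> t u tu [v vs uv]; exists v => //; exact: prefix_trans uv.
    move=> [x /(_ (\max_(u <- s) size u).+1) [u us /prefixP[v uE]]].
    have : size u <= \max_(w <- s) size w by exact: leq_bigmax_seq.
    by rewrite leqNgt [X in _ < size X]uE size_cat size_mkseq ltnS leq_addr.
  by move=> t ts; exists t => //; exact: prefix_refl.
- by move=> A B AB [T wT BT]; exists T => //; exact: subset_trans AB BT.
- move=> A B [S wS AS] [T wT BT]; exists (S `|` T).
    exact: well_founded_treeU.
  exact: setUSS.
Qed.

(* Main.v *)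
Require Import Defs.
From mathcomp Require Import all_boot.
From mathcomp Require Import boolp classical_sets functions cardinality.

Local Open Scope classical_set_scope.

(** Call an ideal embeddable when it is isomorphic to a restriction of I_wf.
    By induction on the construction of I in B, both I and its orthogonal are
    embeddable.  The orthogonal step is free, because restrictions of I_wf are
    Frechet, i.e. equal to their double orthogonal.  For a direct sum, place the
    copy of the n-th ideal above the node <n>: a set is in I_wf iff each of its
    sections is.  The orthogonal of a direct sum consists of the sets which meet
    only finitely many pieces, each in a member of the orthogonal of that piece;
    place the copy of the n-th orthogonal above the node 0^n 1, so that the
    branch 000... forbids meeting infinitely many pieces. *)

(** * Injections, initial segments and membership in [Iwf] *)

Lemma finite_image_inj (S T : Type) (f : S -> T) (A : set S) :
  set_inj A f -> finite_set (f @` A) -> finite_set A.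
Proof. by move=> /inj_card_eq /eq_finite_set ->. Qed.

Lemma sub_set_inj (S T : Type) (f : S -> T) (A B : set S) :
  A `<=` B -> set_inj B f -> set_inj A f.
Proof. by move=> AB injf; apply: sub_in2 injf => x; rewrite !inE => /AB. Qed.

Lemma mkseq_consl (T : Type) (x : nat -> T) n :
  mkseq x n.+1 = x 0 :: mkseq (x \o succn) n.
Proof. by rewrite /mkseq /= (iotaDl 1 0) -map_comp. Qed.

Lemma mkseq_cst (T : Type) (a : T) n : mkseq (fun=> a) n = nseq n a.
Proof. by elim: n => // n IH; rewrite mkseq_consl IH. Qed.

Lemma prefix_mkseq (x : nat -> nat) m n : m <= n ->
  prefix (mkseq x m) (mkseq x n).
Proof. by move=> mn; rewrite /mkseq -(subnKC mn) iotaD map_cat prefix_prefix. Qed.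

(** The downward closure of [A] is the least tree containing [A], so only its branches have to be
    excluded. *)
Lemma IwfP (A : set (seq nat)) :
  Iwf A <-> forall x : nat -> nat, exists n,
              forall u, A u -> ~~ prefix (mkseq x n) u.
Proof.
split.
  move=> [T [trT nT] AT] x; apply: contrapT => nx; apply: nT; exists x => n.
  apply: contrapT => nTx; apply: nx; exists n => u /AT Tu; apply/negP => xu.
  by apply: nTx; apply: trT Tu.
move=> h; exists [set s | exists2 u, A u & prefix s u]; last first.
  by move=> u Au; exists u => //; exact: prefix_refl.
split; first by move=> s t st [u Au tu]; exists u => //; exact: prefix_trans tu.
move=> [x xA]; have [n hn] := h x; have [u Au xu] := xA n.
by move: (hn _ Au); rewrite xu.
Qed.

Lemma sub_Iwf {A B : set (seq nat)} : A `<=` B -> Iwf B -> Iwf A.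
Proof. by case: Iwf_ideal => _ _ _ + _; exact. Qed.

Lemma IwfU (A B : set (seq nat)) : Iwf A -> Iwf B -> Iwf (A `|` B).
Proof. by case: Iwf_ideal => _ _ _ _; exact. Qed.

Lemma Iwf0 : Iwf set0.
Proof. by apply/IwfP => x; exists 0. Qed.

(** A branch of the closure of [A] has a fixed first entry [n], and its tail is a branch of the
    closure of the section at [n]; so no uniformity in [n] is required. *)
Lemma Iwf_heads (A : set (seq nat)) :
  Iwf A <-> forall n, Iwf [set s | A (n :: s)].
Proof.
split=> [/IwfP h n|h]; apply/IwfP => x.
  have [m hm] := h (fun i => if i is j.+1 then x j else n).
  exists m => s /hm; apply: contra => xs.
  apply: prefix_trans (prefix_mkseq _ m m.+1 (leqnSn m)) _.
  by rewrite mkseq_consl prefix_cons eqxx.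
have /IwfP/(_ (x \o succn))[m hm] := h (x 0); exists m.+1 => u Au.
rewrite mkseq_consl; case: u Au => [|k s] // Aks.
rewrite prefix_cons; apply/negP => /andP[/eqP xk].
by apply/negP/hm; rewrite /= xk.
Qed.

Lemma Iwf_cat (p : seq nat) (S : set (seq nat)) : Iwf (cat p @` S) <-> Iwf S.
Proof.
elim: p S => [|n p IH] S; first by rewrite image_id.
rewrite -(IH S) Iwf_heads; split.
  by move=> /(_ n); apply: sub_Iwf => _ [s Ss <-]; exists s.
by move=> h m; apply: sub_Iwf h => _ [s Ss [_ <-]]; exists s.
Qed.

(** These nodes are pairwise incomparable and converge to the zero branch. *)
Definition comb (n : nat) : seq nat := rcons (nseq n 0) 1.

Lemma comb_cat_inj m n s t : comb m ++ s = comb n ++ t -> m = n /\ s = t.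
Proof.
elim: m n => [|m IH] [|n] //=; first by case.
by case=> /IH[-> ->].
Qed.

Lemma prefix_comb n s : prefix (mkseq (fun=> 0) n) (comb n ++ s).
Proof. by rewrite mkseq_cst /comb -cats1 -catA prefix_prefix. Qed.

(** Testing [A] on the zero branch bounds the cones that it meets; under such a bound, [A] is a
    finite union of translates of members of [Iwf]. *)
Lemma Iwf_comb (A : set (seq nat)) :
  (forall u, A u -> exists n s, u = comb n ++ s) ->
  (Iwf A <-> (exists N, forall n s, A (comb n ++ s) -> n < N) /\
             forall n, Iwf [set s | A (comb n ++ s)]).
Proof.
move=> combA; split=> [wA|[[N hN] h]].
  split; last by move=> n; apply/(Iwf_cat (comb n)); apply: sub_Iwf wA => _ [s ? <-].
  have /IwfP/(_ (fun=> 0))[N hN] := wA; exists N => n s /hN; rewrite ltnNge.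
  by apply: contra => Nn; apply: prefix_trans (prefix_comb n s); exact: prefix_mkseq.
suff: forall N, Iwf [set u | A u /\ exists n s, n < N /\ u = comb n ++ s].
  move=> /(_ N); apply: sub_Iwf => u Au; split=> //.
  have [n [s us]] := combA _ Au; exists n, s; split=> //.
  by apply: (hN n s); rewrite -us.
elim=> [|M IH]; first by apply: sub_Iwf Iwf0 => u [_ [n [s []]]].
have /(Iwf_cat (comb M)) hM := h M.
apply: sub_Iwf (IwfU _ _ IH hM) => u [Au [n [s [+ us]]]].
rewrite ltnS leq_eqVlt => /predU1P[nM|nM]; last by left; split=> //; exists n, s.
by right; exists s; rewrite /= -nM -us.
Qed.

(* If the downward closure of A has a branch x, a sequence in A
   converging to x is almost disjoint from every member of I_wf. *)
Lemma Iwf_frechet (A : set (seq nat)) : ~ Iwf A ->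
  exists B, [/\ B `<=` A, infinite_set B &
                forall C, Iwf C -> finite_set (C `&` B)].
Proof.
move=> nA.
have [x hx] : exists x : nat -> nat,
    forall n, exists u, A u /\ prefix (mkseq x n) u.
  apply: contrapT => nx; apply/nA/IwfP => x; apply: contrapT => nxn; apply: nx.
  exists x => n; apply: contrapT => nu; apply: nxn; exists n => u Au.
  by apply/negP => xu; apply: nu; exists u.
have [u hu] := choice hx; exists (range u); split.
- by move=> _ [n _ <-]; have [] := hu n.
- move=> /finite_seqP[s su].
  (* Were the range finite, [N] would bound all lengths, but [u N.+1] extends an initial segment of
     length [N.+1]. *)
  pose N := \max_(v <- s) size v; have uN : u N.+1 \in s.
    by have : range u (u N.+1) by [exists N.+1]; rewrite su.
  have [_ /prefixP[v uE]] := hu N.+1.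
  have : size (u N.+1) <= N by exact: leq_bigmax_seq.
  by rewrite uE size_cat size_mkseq leqNgt ltnS leq_addr.
- move=> C /IwfP/(_ x)[n hn].
  (* No member of [C] extends [mkseq x n], whereas [u m] does for [m >= n]; only the first [n] terms
     can lie in [C]. *)
  apply: sub_finite_set (finite_image u (finite_II n)) => v [Cv [m _ umv]].
  exists m => //=; rewrite ltnNge; apply/negP => nm.
  move: (hn _ Cv); rewrite -umv (prefix_trans _ (proj2 (hu m))) //.
  exact: prefix_mkseq.
Qed.

(** * Embeddable ideals: transport and double orthogonal *)

(** Isomorphism with the restriction of [Iwf] to the image of [X], phrased without naming that
    image. *)
Definition Iwf_embeds {T : Type} (X : set T) (I : set (set T)) : Prop :=
  exists2 f : T -> seq nat, set_inj X f &
    forall A, A `<=` X -> (I A <-> Iwf (f @` A)).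

Lemma Iwf_embeds_iso (S : pointedType) (T : Type) (X : set S) I (Y : set T) J :
  ideal_iso X I Y J -> Iwf_embeds X I -> Iwf_embeds Y J.
Proof.
move=> [f [fXY injf surjf] fIJ] [e inje eI].
(* [g] inverts [f] on [Y]; elsewhere it takes the arbitrary value [point]. *)
have /choice[g hg] : forall y, exists x, Y y -> X x /\ f x = y.
  move=> y; have [Yy|nYy] := pselect (Y y); last by exists point.
  by have [x Xx xy] := surjf _ Yy; exists x.
exists (e \o g) => [y z /set_mem Yy /set_mem Yz /= /inje|A AY].
  have [Xy fy] := hg _ Yy; have [Xz fz] := hg _ Yz.
  by rewrite !inE => /(_ Xy Xz) /(congr1 f); rewrite fy fz.
have gAX : g @` A `<=` X by move=> _ [y /AY /hg[? _] <-].
rewrite -image_comp -eI // fIJ // (_ : f @` (g @` A) = A) //.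
apply/seteqP; split=> [_ [_ [y Ay <-] <-]|y Ay].
  by have [_ ->] := hg _ (AY _ Ay).
by exists (g y); [exists y|have [] := hg _ (AY _ Ay)].
Qed.

Lemma orthogonal_iso (S T : Type) (X : set S) I (Y : set T) J :
  (forall A, I A -> A `<=` X) -> (forall A, J A -> A `<=` Y) ->
  ideal_iso X I Y J -> ideal_iso X (orthogonal X I) Y (orthogonal Y J).
Proof.
move=> subI subJ [f fbij fIJ]; have [fXY injf surjf] := fbij.
exists f => // A AX; split=> [[_ hA]|[_ hA]]; split=> //.
- by move=> _ [x /AX Xx <-]; exact: fXY.
- move=> C JC; have CE : f @` (X `&` f @^-1` C) = C.
    apply/seteqP; split=> [_ [x [_ Cx] <-] //|y Cy].
    by have [x Xx xy] := surjf _ (subJ _ JC _ Cy); exists x; rewrite //= xy.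
  have IC : I (X `&` f @^-1` C) by apply/fIJ; [move=> x []|rewrite CE].
  apply: sub_finite_set (finite_image f (hA _ IC)) => y [Cy [x Ax xy]].
  by exists x => //; split=> //; split; [exact: AX|rewrite /= xy].
- move=> C IC; apply: (@finite_image_inj _ _ f).
    by apply: sub_set_inj injf => x [_ /AX].
  have /hA : J (f @` C) by apply/fIJ => //; exact: subI.
  by apply: sub_finite_set; exact: sub_image_setI.
Qed.

(** If [A] is not in [I], its image contains an infinite [B] almost disjoint from all of [Iwf]. The
    preimage of [B] in [A] is then an infinite subset of [A] lying in the orthogonal of [I]. *)
Lemma Iwf_embeds_orthogonalK (T : Type) (X : set T) I :
  (forall A, I A -> A `<=` X) -> Iwf_embeds X I ->
  orthogonal X (orthogonal X I) = I.
Proof.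
move=> subI [f injf fI]; apply/seteqP; split=> A; last first.
  by move=> IA; split=> [|B [_ /(_ _ IA)]]; [exact: subI|rewrite setIC].
move=> [AX hA]; apply: contrapT; rewrite fI // => /Iwf_frechet[B [BA infB hB]].
have Binj : set_inj (A `&` f @^-1` B) f.
  by apply: sub_set_inj injf => x [/AX].
apply: infB; have -> : B = f @` (A `&` f @^-1` B).
  apply/seteqP; split=> [y By|_ [x [_ ?] <-] //].
  by have [x Ax xy] := BA _ By; exists x; rewrite //= xy.
apply: finite_image; apply: sub_finite_set (hA (A `&` f @^-1` B) _).
  by move=> x [Ax Bx].
split=> [x [/AX]//|C IC]; apply: (@finite_image_inj _ _ f).
  by apply: sub_set_inj Binj => x [].
have /hB : Iwf (f @` C) by apply/fI => //; exact: subI.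
by apply: sub_finite_set => _ [x [Cx [_ Bx]] <-]; split=> //; exists x.
Qed.

(** * Direct sums and their orthogonals *)

Lemma partition_index (T : Type) (D : set nat) (K : nat -> set T) :
  partition D K [set: T] ->
  {i : T -> nat | (forall k, D (i k)) /\ forall n k, D n -> (K n k <-> i k = n)}.
Proof.
move=> [covK trivK _].
have /choice[i hi] : forall k, exists n, D n /\ K n k.
  move=> k; have : cover D K k by rewrite covK.
  by move=> [n Dn Kn]; exists n.
exists i; split=> [k|n k Dn]; first by have [] := hi k.
split=> [Kn|<-]; last by have [] := hi k.
by apply: trivK => //; [have [] := hi k|exists k; split=> //; have [] := hi k].
Qed.

(** The direct sum once the pieces and the copies on them are fixed. *)
Definition glued_sum {T : Type} (D : set nat) (K : nat -> set T)
    (I : nat -> set (set T)) : set (set T) :=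
  [set A | forall n, D n -> I n (A `&` K n)].

Lemma Iwf_embeds_family (T : Type) (D : set nat) (K : nat -> set T) I :
  (forall n, D n -> Iwf_embeds (K n) (I n)) ->
  exists h : nat -> T -> seq nat, forall n, D n -> set_inj (K n) (h n) /\
    forall A, A `<=` K n -> (I n A <-> Iwf (h n @` A)).
Proof.
move=> hI; suff /choice[h ?] : forall n, exists h : T -> seq nat,
    D n -> set_inj (K n) h /\ forall A, A `<=` K n -> (I n A <-> Iwf (h @` A)).
  by exists h.
move=> n; have [/hI[h ? ?]|nD] := pselect (D n); first by exists h.
by exists (fun=> [::]).
Qed.

Lemma Iwf_embeds_glued_sum (T : Type) (D : set nat) (K : nat -> set T) I :
  partition D K [set: T] -> (forall n, D n -> Iwf_embeds (K n) (I n)) ->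
  Iwf_embeds [set: T] (glued_sum D K I).
Proof.
move=> /partition_index[i [Di Ki]] /Iwf_embeds_family[h hI].
exists (fun k => i k :: h (i k) k) => [k l _ _ [ikl]|A _].
  have [inj _] := hI _ (Di k); rewrite -ikl => /inj.
  by apply; rewrite inE Ki.
have secE n : D n ->
    [set s | ((fun k => i k :: h (i k) k) @` A) (n :: s)] = h n @` (A `&` K n).
  move=> Dn; apply/seteqP; split=> s.
    by move=> [k Ak [ikn <-]]; exists k; rewrite ?ikn //; split=> //; apply/Ki.
  by move=> [k [Ak /Ki ikn] <-]; exists k => //; rewrite ikn.
rewrite Iwf_heads; split=> hA n.
  have [Dn|nDn] := pselect (D n).
    by rewrite secE //; apply/(proj2 (hI _ Dn)); [move=> k []|exact: hA].
  (* Labels [i k] always lie in [D], so the section at any other [n] is empty. *)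
  by apply: sub_Iwf Iwf0 => s [k _ [ikn _]]; apply: nDn; rewrite -ikn.
by move=> Dn; apply/(proj2 (hI _ Dn)); [move=> k []|rewrite -secE].
Qed.

Lemma orthogonal_glued_sum (T : pointedType) (D : set nat) (K : nat -> set T) I :
  partition D K [set: T] -> (forall n, D n -> is_ideal (K n) (I n)) ->
  orthogonal [set: T] (glued_sum D K I) =
  [set B | (exists N, forall n, D n -> B `&` K n !=set0 -> n < N) /\
           glued_sum D K (fun n => orthogonal (K n) (I n)) B].
Proof.
move=> /partition_index[i [Di Ki]] idI; apply/seteqP; split=> B; last first.
  move=> [[N hN] hB]; split=> // A hA.
  apply: sub_finite_set (_ : finite_set
      (\bigcup_(n in [set n | n < N /\ D n]) ((A `&` K n) `&` (B `&` K n)))).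
    move=> k [Ak Bk]; have Kk : K (i k) k by apply/Ki.
    by exists (i k) => //; split=> //; apply: hN => //; exists k.
  apply: bigcup_finite; first by apply: sub_finite_set (finite_II N) => n [].
  by move=> n [_ Dn]; have [_] := hB _ Dn; apply; exact: hA.
move=> [_ hB]; split; last first.
  move=> n Dn; split=> [k []//|A IA].
  have AK := ideal_carrier (idI _ Dn) IA.
  (* A member of [I n] belongs to the glued sum, as it meets every other piece in the empty set. *)
  apply: sub_finite_set (hB A _); first by move=> k [? []].
  move=> m Dm; have [<-|nm] := pselect (n = m).
    by apply: (ideal_sub (idI _ Dn)) IA => k [].
  apply: (ideal_finite (idI _ Dm)); first by move=> k [].
  rewrite (_ : _ `&` _ = set0) // -subset0 => k [/AK /Ki kn /Ki km].
  by apply: nm; rewrite -kn // km.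
(* A selector of the pieces met by B belongs to the sum, so it is finite. *)
have /choice[c hc] : forall n, exists k,
    (exists2 l, B l & i l = n) -> B k /\ i k = n.
  move=> n; have [[k Bk kn]|?] := pselect (exists2 k, B k & i k = n).
    by exists k.
  by exists point.
have : glued_sum D K I [set k | B k /\ c (i k) = k].
  move=> n Dn; apply: (ideal_finite (idI _ Dn)) => [k []//|].
  apply: sub_finite_set (finite_set1 (c n)) => k [[_ ck] /Ki ikn].
  by move: ck; rewrite ikn.
move=> /hB/(finite_image i)/finite_seqP[s sE].
(* [s] lists the indices of the selected points, hence of all pieces met by [B]. *)
exists (\max_(m <- s) m).+1 => n Dn [k [Bk /Ki ikn]]; rewrite ltnS.
have ns : n \in s.
  have [Bc icn] := hc n (ex_intro2 _ _ k Bk (ikn Dn)).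
  have : (i @` ([set k | B k /\ c (i k) = k] `&` B)) n.
    by exists (c n) => //; split=> //; split=> //; rewrite icn.
  by rewrite sE.
exact: (@leq_bigmax_seq _ _ xpredT id).
Qed.

Lemma Iwf_embeds_orthogonal_glued_sum (T : pointedType) (D : set nat)
    (K : nat -> set T) I :
  partition D K [set: T] -> (forall n, D n -> is_ideal (K n) (I n)) ->
  (forall n, D n -> Iwf_embeds (K n) (orthogonal (K n) (I n))) ->
  Iwf_embeds [set: T] (orthogonal [set: T] (glued_sum D K I)).
Proof.
move=> partK idI /Iwf_embeds_family[h hI]; rewrite orthogonal_glued_sum //.
have [i [Di Ki]] := partition_index _ _ _ partK.
pose F k := comb (i k) ++ h (i k) k; exists F => [k l _ _|B _].
  rewrite /F => /comb_cat_inj[ikl]; rewrite -ikl.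
  by have [inj _] := hI _ (Di k); move=> /inj; apply; rewrite inE Ki.
have secE n : D n -> [set s | (F @` B) (comb n ++ s)] = h n @` (B `&` K n).
  move=> Dn; apply/seteqP; split=> s.
    move=> [k Bk /comb_cat_inj[ikn <-]].
    by exists k; rewrite ?ikn //; split=> //; apply/Ki.
  by move=> [k [Bk /Ki ikn] <-]; exists k => //; rewrite /F ikn.
rewrite Iwf_comb; last by move=> _ [k _ <-]; exists (i k), (h (i k) k).
split=> -[[N hN] hB]; split.
- exists N => n s [k Bk /comb_cat_inj[<- _]].
  by apply: hN => //; exists k; split=> //; apply/Ki.
- move=> n; have [Dn|nDn] := pselect (D n).
    by rewrite secE //; apply/(proj2 (hI _ Dn)); [move=> k []|exact: hB].
  by apply: sub_Iwf Iwf0 => s [k _ /comb_cat_inj[ikn _]]; apply: nDn; rewrite -ikn.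
- exists N => n Dn [k [Bk /Ki ikn]]; apply: (hN n (h n k)).
  by exists k => //; rewrite /F ikn.
- by move=> n Dn; apply/(proj2 (hI _ Dn)); [move=> k []|rewrite -secE].
Qed.

(** * Base case and induction over [BB] *)

Lemma Iwf_embeds_finite : Iwf_embeds [set: nat] [set A | finite_set A].
Proof.
have injf : set_inj [set: nat] (nseq ^~ 0).
  by move=> m n _ _ /(congr1 size); rewrite !size_nseq.
(* All these nodes lie on the zero branch, so infinitely many of them force that branch into any
   tree containing them. *)
exists (nseq ^~ 0) => // A _; split=> [fA|/IwfP/(_ (fun=> 0))[N hN]].
  by apply: (ideal_finite Iwf_ideal) => //; exact: finite_image.
apply: sub_finite_set (finite_II N) => n An /=; rewrite ltnNge; apply/negP => Nn.
have /hN/negP : ((nseq ^~ 0) @` A) (nseq n 0) by exists n.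
by apply; rewrite -mkseq_cst; exact: prefix_mkseq.
Qed.

(** This orthogonal is the full power set, and the set of all sequences of length one is in
    [Iwf]. *)
Lemma Iwf_embeds_orthogonal_finite :
  Iwf_embeds [set: nat] (orthogonal [set: nat] [set A | finite_set A]).
Proof.
exists (fun n => [:: n]) => [m n _ _ []//|A _]; split=> _.
  apply/Iwf_heads => n; apply: (ideal_finite Iwf_ideal) => //.
  by apply: sub_finite_set (finite_set1 [::]) => s [m _ [_ <-]].
by split=> // B fB; exact: finite_setIl.
Qed.

Lemma BB_Iwf_embeds {I : set (set nat)} : BB I ->
  Iwf_embeds [set: nat] I /\ Iwf_embeds [set: nat] (orthogonal [set: nat] I).
Proof.
elim=> {I} [|I J bI [eI eoI] idJ isoIJ|I bI [eI eoI]|D I J bI eI].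
- by split; [exact: Iwf_embeds_finite|exact: Iwf_embeds_orthogonal_finite].
- split; first exact: Iwf_embeds_iso isoIJ eI.
  by apply: Iwf_embeds_iso eoI; exact: orthogonal_iso.
(* Passing to the orthogonal swaps the two induction hypotheses, since the double orthogonal is [I]
   again. *)
- split=> //; rewrite Iwf_embeds_orthogonalK //.
- move=> [K [I' [partK hI' ->]]]; split.
    apply: Iwf_embeds_glued_sum => // n Dn.
    by have [_ iso] := hI' _ Dn; apply: Iwf_embeds_iso iso (proj1 (eI _ Dn)).
  apply: Iwf_embeds_orthogonal_glued_sum => // n Dn; first by have [] := hI' _ Dn.
  have [idI' iso] := hI' _ Dn; apply: Iwf_embeds_iso (proj2 (eI _ Dn)).
  by apply: orthogonal_iso => //; case: idI'.
Qed.

Theorem mainTheorem2 (I : set (set nat)) (hI : BB I) :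
  exists A : set (seq nat),
    ideal_iso [set: nat] I A (restriction Iwf A).
Proof.
have [[f injf fI] _] := BB_Iwf_embeds hI; exists (range f), f.
  by split=> // n _; exists n.
move=> A _; rewrite fI //; split=> [fA|[]//].
by split=> // _ [n _ <-]; exists n.
Qed.
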